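(* Let $(\mathsf{u}_t)_{t\in\mathbb{R}}$ be a normalized path of pairwise ultraparallel spacelike vectors in $\mathsf{V}$. Suppose $(p_t)_{t\in\mathbb{R}}$ is a regular curve in $\mathsf{E}$ such that, for every $t\in\mathbb{R}$, $\dot p_t\in \mathsf{V}_{\neq 0}(\mathsf{u}_t)$. Then $\{\mathcal{C}(p_t,\mathsf{u}_t)\}_{t\in\mathbb{R}}$ is a crooked foliation.
   Context: $\mathsf{V}=\mathbb{R}^3$ with scalar product $\mathsf{x}\cdot\mathsf{y}=x_1y_1+x_2y_2-x_3y_3$; $\mathsf{E}$ is the affine space modeled on $\mathsf{V}$. A nonzero vector $\mathsf{v}$ is timelike, null, or spacelike if $\mathsf{v}\cdot\mathsf{v}$ is $<0$, $=0$, $>0$ respectively. $\mathsf{v}^\perp$ is the set of vectors orthogonal to $\mathsf{v}$ for this product. Null frame: for $\mathsf{u}$ spacelike, $\mathsf{u}^-,\mathsf{u}^+$ are the null vectors with third coordinate $1$ such that $\mathsf{u}^\perp=\langle \mathsf{u}^-,\mathsf{u}^+\rangle$ and $\det[\mathsf{u}\ \mathsf{u}^-\ \mathsf{u}^+]>0$. Crooked plane $\mathcal{C}(p,\mathsf{u})$ with vertex $p\in\mathsf{E}$ and (spacelike) director $\mathsf{u}$: the union of the stem $p+\{\mathsf{x}\in\mathsf{u}^\perp:\mathsf{x}\cdot\mathsf{x}\le 0\}$ and the two wings $p+\{\mathsf{x}\in(\mathsf{u}^+)^\perp \text{ spacelike}:\mathsf{x}^+=\mathsf{u}^+\}$ and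 $p+\{\mathsf{x}\in(\mathsf{u}^-)^\perp\text{ spacelike}:\mathsf{x}^+=\mathsf{u}^-\}$. Stem quadrant: $\mathsf{V}_{\neq 0}(\mathsf{u})=\{a\mathsf{u}^- - b\mathsf{u}^+ : a,b\ge 0\}\setminus\{0\}$. Spacelike vectors $\mathsf{u}_1,\mathsf{u}_2$ are crossing, ultraparallel, or asymptotic if the line $\mathsf{u}_1^\perp\cap\mathsf{u}_2^\perp$ is timelike, spacelike, or null respectively; ultraparallel or asymptotic pairs are non-crossing. A non-crossing pair of spacelike vectors $\mathsf{u}_1,\mathsf{u}_2$ is consistently oriented if $\mathsf{u}_1\cdot\mathsf{u}_2<0$ and $\mathsf{u}_i\cdot\mathsf{u}_j^{\pm}\le 0$ for $i,j=1,2$. A continuous path $(\mathsf{u}_t)_{t\in\mathbb{R}}$ of pairwise non-crossing spacelike vectors is normalized if for all $s>t$ the vectors $\mathsf{u}_s,-\mathsf{u}_t$ are consistently oriented. A regular curve is a smooth parametrized curve with nowhere zero tangent vector. A crooked foliation is a family $\{\mathcal{C}(p_t,\mathsf{u}_t)\}_{t\in\mathbb{R}}$ of pairwise disjoint crooked planes, where $(\mathsf{u}_t)$ is a continuous curve of spacelike vectors and $(p_t)$ is a regular curve in $\mathsf{E}$. *)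

(* Defs.v *)
From HB Require Import structures.
From mathcomp Require Import all_boot all_order all_algebra.
From mathcomp Require Import all_classical all_reals all_analysis.
From mathcomp Require Import ring lra.
Import Order.TTheory GRing.Theory Num.Theory.
Import numFieldNormedType.Exports.

Set Implicit Arguments.
Unset Strict Implicit.
Unset Printing Implicit Defensive.

Local Open Scope ring_scope.
Local Open Scope classical_set_scope.

(* Both the vector space V = R^3 and the affine space E modeled on it are
   represented by 'rV[R]_3 (E being V acting on itself by translations);
   in coordinates x1 = x 0 0, x2 = x 0 1, x3 = x 0 2. *)

Definition dot (R : realType) (x y : 'rV[R]_3) : R :=
  x 0 0 * y 0 0 + x 0 1 * y 0 1 - x 0 2 * y 0 2.

Definition timelike (R : realType) (v : 'rV[R]_3) : Prop :=
  v != 0 /\ dot v v < 0.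

Definition null (R : realType) (v : 'rV[R]_3) : Prop :=
  v != 0 /\ dot v v = 0.

Definition spacelike (R : realType) (v : 'rV[R]_3) : Prop :=
  v != 0 /\ 0 < dot v v.

Definition orth (R : realType) (v : 'rV[R]_3) : set 'rV[R]_3 :=
  [set x | dot x v = 0].

Definition line (R : realType) (v : 'rV[R]_3) : set 'rV[R]_3 :=
  [set a *: v | a in [set: R]].

Definition plane (R : realType) (v w : 'rV[R]_3) : set 'rV[R]_3 :=
  [set a *: v + b *: w | a in [set: R] & b in [set: R]].

Definition cols3 (R : realType) (x y z : 'rV[R]_3) : 'M[R]_3 :=
  \matrix_(i, j) [:: x; y; z]`_j 0 i.

(* [is_null_frame u (um, up)]: um and up are the vectors u^- and u^+. *)
Definition is_null_frame (R : realType) (u : 'rV[R]_3)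
    (f : 'rV[R]_3 * 'rV[R]_3) : Prop :=
  [/\ null f.1 /\ f.1 0 2 = 1, null f.2 /\ f.2 0 2 = 1,
      orth u = plane f.1 f.2 & 0 < \det (cols3 u f.1 f.2)].

Definition vec3 (R : realType) (x y z : R) : 'rV[R]_3 := \row_j [:: x; y; z]`_j.

Lemma vec3E (R : realType) (x y z : R) :
  (vec3 x y z 0 0 = x) * (vec3 x y z 0 1 = y) * (vec3 x y z 0 2 = z).
Proof. by rewrite /vec3 !mxE. Qed.

Lemma vec3P (R : realType) (v w : 'rV[R]_3) :
  v 0 0 = w 0 0 -> v 0 1 = w 0 1 -> v 0 2 = w 0 2 -> v = w.
Proof.
move=> h0 h1 h2; apply/rowP => -[[|[|[|//]]] i3].
- by rewrite (_ : Ordinal i3 = 0) //; apply: val_inj.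
- by rewrite (_ : Ordinal i3 = 1) //; apply: val_inj.
- by rewrite (_ : Ordinal i3 = 2) //; apply: val_inj.
Qed.

Lemma det_cols3 (R : realType) (x y z : 'rV[R]_3) :
  \det (cols3 x y z) =
    x 0 0 * (y 0 1 * z 0 2 - y 0 2 * z 0 1)
  - x 0 1 * (y 0 0 * z 0 2 - y 0 2 * z 0 0)
  + x 0 2 * (y 0 0 * z 0 1 - y 0 1 * z 0 0).
Proof.
rewrite (expand_det_col _ 0) !big_ord_recl big_ord0 /cofactor.
rewrite !(expand_det_row _ 0) !big_ord_recl !big_ord0 /cofactor !det_mx11 !mxE /=.
have e1 : lift ord0 ord0 = 1 :> 'I_3 by apply: val_inj.
have e2 : lift ord0 (lift ord0 ord0) = 2 :> 'I_3 by apply: val_inj.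
have e3 : lift 1 (lift 0 0) = 2 :> 'I_3 by apply: val_inj.
have e4 : lift 1 0 = 0 :> 'I_3 by apply: val_inj.
have e5 : lift 2 0 = 0 :> 'I_3 by apply: val_inj.
have e6 : lift 2 (lift 0 0) = 1 :> 'I_3 by apply: val_inj.
rewrite ?e1 ?e2 /= /bump /= ?e3 ?e4 ?e5 ?e6.
ring.
Qed.

(* The null frame in coordinates: the line [x 0 0 * u1 + x 0 1 * u2 = u3] meets
   the unit circle in the two points below. *)
Definition frame_of (R : realType) (u : 'rV[R]_3) : 'rV[R]_3 * 'rV[R]_3 :=
  let s := Num.sqrt (dot u u) in
  let r := u 0 0 ^+ 2 + u 0 1 ^+ 2 in
  (vec3 ((u 0 2 * u 0 0 - s * u 0 1) / r) ((u 0 2 * u 0 1 + s * u 0 0) / r) 1,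
   vec3 ((u 0 2 * u 0 0 + s * u 0 1) / r) ((u 0 2 * u 0 1 - s * u 0 0) / r) 1).

Lemma vec3_neq0 (R : realType) (x y : R) : vec3 x y 1 != 0.
Proof.
apply/eqP => /rowP /(_ 2); rewrite vec3E mxE => /eqP.
by rewrite oner_eq0.
Qed.

Lemma is_null_frame_frame_of (R : realType) (u : 'rV[R]_3) :
  spacelike u -> is_null_frame u (frame_of u).
Proof.
move=> [_ hu]; rewrite /frame_of.
set s := Num.sqrt _.
have hs : 0 < s by rewrite sqrtr_gt0.
have ss : s ^+ 2 = dot u u by rewrite sqr_sqrtr // ltW.
move: ss hu; rewrite /dot.
set a := u 0 0; set b := u 0 1; set c := u 0 2; move=> ss hu.
have hr : 0 < a ^+ 2 + b ^+ 2 by nra.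
set r := a ^+ 2 + b ^+ 2.
have r0 : r != 0 by rewrite gt_eqF.
have rE : r = s ^+ 2 + c ^+ 2 by rewrite ss /r; ring.
have c1 : dot (vec3 ((c * a - s * b) / r) ((c * b + s * a) / r) 1)
     (vec3 ((c * a - s * b) / r) ((c * b + s * a) / r) 1) = 0.
  rewrite /dot !vec3E.
  have -> : (c * a - s * b) / r * ((c * a - s * b) / r) +
    (c * b + s * a) / r * ((c * b + s * a) / r) - 1 * 1 =
    (s ^+ 2 + c ^+ 2 - r) / r by rewrite /r; field.
  by rewrite -rE subrr mul0r.
have c2 : dot (vec3 ((c * a + s * b) / r) ((c * b - s * a) / r) 1)
     (vec3 ((c * a + s * b) / r) ((c * b - s * a) / r) 1) = 0.
  rewrite /dot !vec3E.
  have -> : (c * a + s * b) / r * ((c * a + s * b) / r) +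
    (c * b - s * a) / r * ((c * b - s * a) / r) - 1 * 1 =
    (s ^+ 2 + c ^+ 2 - r) / r by rewrite /r; field.
  by rewrite -rE subrr mul0r.
split=> /=.
- by rewrite vec3E; split=> //; split; [exact: vec3_neq0 | exact: c1].
- by rewrite vec3E; split=> //; split; [exact: vec3_neq0 | exact: c2].
- apply/seteqP; split => [x|x [al _ [be _ <-]]] /=.
  + rewrite /orth /dot /= -/a -/b -/c => xu.
    have {}xu : c * x 0 2 = x 0 0 * a + x 0 1 * b by move: xu; lra.
    exists ((x 0 2 - (x 0 0 * b - x 0 1 * a) / s) / 2) => //.
    exists ((x 0 2 + (x 0 0 * b - x 0 1 * a) / s) / 2) => //.
    have s0 : s != 0 by rewrite gt_eqF.
    apply: vec3P; rewrite !mxE /=.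
    * have xE : x 0 0 = (c * x 0 2 * a + (x 0 0 * b - x 0 1 * a) * b) / r.
        by rewrite xu /r; field.
      by rewrite [RHS]xE; field; rewrite s0 r0.
    * have xE : x 0 1 = (c * x 0 2 * b - (x 0 0 * b - x 0 1 * a) * a) / r.
        by rewrite xu /r; field.
      by rewrite [RHS]xE; field; rewrite s0 r0.
    * by field.
  + rewrite /orth /dot /= !mxE /= -/a -/b -/c.
    by rewrite /r; field.
- rewrite det_cols3 !vec3E -/a -/b -/c.
  have -> : a * ((c * b + s * a) / r * 1 - 1 * ((c * b - s * a) / r)) -
    b * ((c * a - s * b) / r * 1 - 1 * ((c * a + s * b) / r)) +
    c * ((c * a - s * b) / r * ((c * b - s * a) / r) -
     (c * b + s * a) / r * ((c * a + s * b) / r)) =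
    2 * s * (r - c ^+ 2) / r by rewrite /r; field.
  by rewrite divr_gt0 // mulr_gt0 ?mulr_gt0 // rE addrK exprn_gt0.
Qed.

Lemma is_null_frame_unique (R : realType) (u : 'rV[R]_3) f g :
  spacelike u -> is_null_frame u f -> is_null_frame u g -> f = g.
Proof.
move=> su.
suff H h : is_null_frame u h -> h = frame_of u by move=> /H -> /H ->.
case: h => m p [] /= [[_ mm] m2] [[_ pp] p2] ho; rewrite det_cols3.
have mu : orth u m.
  by rewrite ho; exists 1 => //; exists 0 => //; rewrite scale1r scale0r addr0.
have pu : orth u p.
  by rewrite ho; exists 0 => //; exists 1 => //; rewrite scale1r scale0r add0r.
move: mm pp mu pu su => + + + + [_]; rewrite /orth /dot /= m2 p2 /frame_of.
set s := Num.sqrt _.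
set a := u 0 0; set b := u 0 1; set c := u 0 2.
set x := m 0 0; set y := m 0 1; set x' := p 0 0; set y' := p 0 1.
move=> mm pp mu pu hu hd.
have hs : 0 < s by rewrite sqrtr_gt0.
have ss : s ^+ 2 = a * a + b * b - c * c by rewrite sqr_sqrtr // ltW.
have hr : 0 < a ^+ 2 + b ^+ 2 by nra.
set r := a ^+ 2 + b ^+ 2 in hr *.
have r0 : r != 0 by rewrite gt_eqF.
have cE : c = a * x + b * y by lra.
have cE' : c = a * x' + b * y' by lra.
have yy : y * y = 1 - x * x by lra.
have yy' : y' * y' = 1 - x' * x' by lra.
have t1 : (a * y - b * x) ^+ 2 = s ^+ 2.
  rewrite ss {1}cE {1}cE.
  have -> : (a * y - b * x) ^+ 2 = a * a * (y * y) + b * b * (x * x) - 2 * a * b * x * y by ring.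
  have -> : a * a + b * b - (a * x + b * y) * (a * x + b * y) =
     a * a + b * b - a * a * (x * x) - b * b * (y * y) - 2 * a * b * x * y by ring.
  by rewrite yy; ring.
have t2 : (a * y' - b * x') ^+ 2 = s ^+ 2.
  rewrite ss {1}cE' {1}cE'.
  have -> : (a * y' - b * x') ^+ 2 = a * a * (y' * y') + b * b * (x' * x') - 2 * a * b * x' * y' by ring.
  have -> : a * a + b * b - (a * x' + b * y') * (a * x' + b * y') =
     a * a + b * b - a * a * (x' * x') - b * b * (y' * y') - 2 * a * b * x' * y' by ring.
  by rewrite yy'; ring.
set t := a * y - b * x in t1.
set t' := a * y' - b * x' in t2.
have xE : x = (c * a - t * b) / r by rewrite /t cE /r; field.
have yE : y = (c * b + t * a) / r by rewrite /t cE /r; field.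
have xE' : x' = (c * a - t' * b) / r by rewrite /t' cE' /r; field.
have yE' : y' = (c * b + t' * a) / r by rewrite /t' cE' /r; field.
have tt : 0 < t - t'.
  move: hd; rewrite xE yE xE' yE'.
  set d := (X in 0 < X).
  have -> : d = (t - t') * (s ^+ 2 / r).
    by rewrite ss /d /r; field.
  by rewrite pmulr_lgt0 // divr_gt0 // exprn_gt0.
have ts : t = s.
  move/eqP: t1; rewrite eqf_sqr => /orP[/eqP //|/eqP t1].
  move/eqP: t2; rewrite eqf_sqr => /orP[/eqP t2|/eqP t2]; lra.
have ts' : t' = - s.
  move/eqP: t2; rewrite eqf_sqr => /orP[/eqP t2|/eqP //]; lra.
congr (_, _); apply: vec3P; rewrite !vec3E //.
- by rewrite -/x xE ts.
- by rewrite -/y yE ts.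
- by rewrite -/x' xE' ts'; congr (_ / _); ring.
- by rewrite -/y' yE' ts'; congr (_ / _); ring.
Qed.

(* The default value (0, 0) is irrelevant: a spacelike u has exactly one null
   frame, see [null_frameP] below and
   [is_null_frame_unique]. *)
Definition null_frame (R : realType) (u : 'rV[R]_3) : 'rV[R]_3 * 'rV[R]_3 :=
  xget (0, 0) [set f | is_null_frame u f].

Definition nullm (R : realType) (u : 'rV[R]_3) : 'rV[R]_3 := (null_frame u).1.
Definition nullp (R : realType) (u : 'rV[R]_3) : 'rV[R]_3 := (null_frame u).2.

Lemma null_frameP (R : realType) (u : 'rV[R]_3) :
  spacelike u -> is_null_frame u (nullm u, nullp u).
Proof.
move=> su; rewrite /nullm /nullp -surjective_pairing /null_frame.
by case: xgetP => // /(_ (frame_of u)) []; exact: is_null_frame_frame_of.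
Qed.

Definition translate (R : realType) (p : 'rV[R]_3) (A : set 'rV[R]_3) :
    set 'rV[R]_3 :=
  [set p + x | x in A].

Definition stem (R : realType) (u : 'rV[R]_3) : set 'rV[R]_3 :=
  orth u `&` [set x | dot x x <= 0].

Definition wingp (R : realType) (u : 'rV[R]_3) : set 'rV[R]_3 :=
  orth (nullp u) `&` [set x | spacelike x /\ nullp x = nullp u].

Definition wingm (R : realType) (u : 'rV[R]_3) : set 'rV[R]_3 :=
  orth (nullm u) `&` [set x | spacelike x /\ nullp x = nullm u].

Definition crooked_plane (R : realType) (p u : 'rV[R]_3) : set 'rV[R]_3 :=
  translate p (stem u) `|` translate p (wingp u) `|` translate p (wingm u).

Definition stem_quadrant (R : realType) (u : 'rV[R]_3) : set 'rV[R]_3 :=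
  [set a *: nullm u - b *: nullp u | a in [set a | 0 <= a]
                                   & b in [set b | 0 <= b]] `\ 0.

(* These require u1^perp `&` u2^perp to be a line, i.e., u1 and u2 to be
   linearly independent. *)
Definition crossing (R : realType) (u1 u2 : 'rV[R]_3) : Prop :=
  exists2 v, timelike v & orth u1 `&` orth u2 = line v.

Definition ultraparallel (R : realType) (u1 u2 : 'rV[R]_3) : Prop :=
  exists2 v, spacelike v & orth u1 `&` orth u2 = line v.

Definition asymptotic (R : realType) (u1 u2 : 'rV[R]_3) : Prop :=
  exists2 v, null v & orth u1 `&` orth u2 = line v.

Definition noncrossing (R : realType) (u1 u2 : 'rV[R]_3) : Prop :=
  ultraparallel u1 u2 \/ asymptotic u1 u2.

Definition consistently_oriented (R : realType) (u1 u2 : 'rV[R]_3) : Prop :=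
  [/\ spacelike u1, spacelike u2, noncrossing u1 u2, dot u1 u2 < 0 &
      forall x y, x \in [:: u1; u2] -> y \in [:: u1; u2] ->
        dot x (nullm y) <= 0 /\ dot x (nullp y) <= 0].

Definition normalized_path (R : realType) (u : R -> 'rV[R]_3) : Prop :=
  [/\ continuous u,
      forall t, spacelike (u t),
      forall s t, s != t -> noncrossing (u s) (u t) &
      forall s t, t < s -> consistently_oriented (u s) (- u t)].

Definition smooth_curve (R : realType) (p : R -> 'rV[R]_3) : Prop :=
  forall (n : nat) (t : R), derivable (p^`(n)) t 1.

Definition regular_curve (R : realType) (p : R -> 'rV[R]_3) : Prop :=
  smooth_curve p /\ forall t, p^`() t != 0.

Definition crooked_foliation (R : realType) (p u : R -> 'rV[R]_3) : Prop :=
  [/\ continuous u,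
      forall t, spacelike (u t),
      regular_curve p &
      forall s t, s != t ->
        crooked_plane (p s) (u s) `&` crooked_plane (p t) (u t) = set0].

(* Main.v *)
Require Import Defs.
From HB Require Import structures.
From mathcomp Require Import all_boot all_order all_algebra.
From mathcomp Require Import ring lra.
From mathcomp Require Import all_classical all_reals all_analysis.
Import Order.TTheory GRing.Theory Num.Theory.
Import numFieldNormedType.Exports.

Set Implicit Arguments.
Unset Strict Implicit.

Local Open Scope ring_scope.
Local Open Scope classical_set_scope.

(* Let [a], [c] be the null directions of [u_t], and [b], [d] those of [u_s], for
   [t < s].  For [r] in [(t, s)] the chord joining the null directions of [u_r]
   separates [a, c] from [b, d] on the circle of null directions, so that for
   [x] in [{a, c}] and [x'] in [{b, d}] the functional [det (x, x', -)] is
   positive on the stem quadrant of [u_r].  By the mean value theorem, these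
   four functionals are positive on [p_s - p_t].  On the other hand, if [y] is in
   [C(0, u_t)] then some [x] in [{a, c}] satisfies [det (x, x', y) <= 0] for both
   [x'], and symmetrically if [z] is in [C(0, u_s)] then some [x'] satisfies
   [det (x, x', z) >= 0] for both [x].  Hence one of the functionals is
   nonpositive on [y - z], which therefore differs from [p_s - p_t]. *)

Local Notation det3 x y z := (\det (cols3 x y z)).

(** These vectors form a circle that meets each null line exactly once. *)
Definition null1 (R : realType) (x : 'rV[R]_3) : Prop := null x /\ x 0 2 = 1.

Lemma dotC (R : realType) (x y : 'rV[R]_3) : dot x y = dot y x.
Proof. by rewrite /dot; ring. Qed.

Lemma dotNl (R : realType) (x y : 'rV[R]_3) : dot (- x) y = - dot x y.
Proof. by rewrite /dot !mxE; ring. Qed.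

Lemma dotNr (R : realType) (x y : 'rV[R]_3) : dot x (- y) = - dot x y.
Proof. by rewrite dotC dotNl dotC. Qed.

Lemma dot_lin (R : realType) (x y z : 'rV[R]_3) (a b : R) :
  dot x (a *: y + b *: z) = a * dot x y + b * dot x z.
Proof. by rewrite /dot !mxE; ring. Qed.

Lemma det3_lin (R : realType) (x y z w : 'rV[R]_3) (a b : R) :
  det3 x y (a *: z + b *: w) = a * det3 x y z + b * det3 x y w.
Proof. by rewrite !det_cols3 !mxE; ring. Qed.

Lemma det3B (R : realType) (x y z w : 'rV[R]_3) :
  det3 x y (z - w) = det3 x y z - det3 x y w.
Proof. by rewrite !det_cols3 !mxE; ring. Qed.

Lemma det3N1 (R : realType) (x y z : 'rV[R]_3) :
  det3 (- x) y z = - det3 x y z.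
Proof. by rewrite !det_cols3 !mxE; ring. Qed.

Lemma det3_swap12 (R : realType) (x y z : 'rV[R]_3) :
  det3 y x z = - det3 x y z.
Proof. by rewrite !det_cols3; ring. Qed.

Lemma det3_swap23 (R : realType) (x y z : 'rV[R]_3) :
  det3 x z y = - det3 x y z.
Proof. by rewrite !det_cols3; ring. Qed.

Lemma det3_xyx (R : realType) (x y : 'rV[R]_3) : det3 x y x = 0.
Proof. by rewrite det_cols3; ring. Qed.

Lemma det3_xyy (R : realType) (x y : 'rV[R]_3) : det3 x y y = 0.
Proof. by rewrite det_cols3; ring. Qed.

(* Four vectors of a three-dimensional space are linearly dependent, with
   coefficients given by their 3 x 3 minors; pair this relation with [w]. *)
Lemma dot_det3 (R : realType) (x y z t w : 'rV[R]_3) :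
  dot x w * det3 y z t - dot y w * det3 x z t
  + dot z w * det3 x y t - dot t w * det3 x y z = 0.
Proof. by rewrite !det_cols3 /dot; ring. Qed.

(** Here [dot x y] is minus half the squared Euclidean distance from [x] to [y]. *)
Lemma dot_null1_le0 (R : realType) (x y : 'rV[R]_3) :
  null1 x -> null1 y -> dot x y <= 0.
Proof.
move=> [[_ +] x2] [[_ +] y2]; rewrite /dot x2 y2 => xx yy.
have := sqr_ge0 (x 0 0 - y 0 0); have := sqr_ge0 (x 0 1 - y 0 1); nra.
Qed.

Lemma dot_null1_lt0 (R : realType) (x y : 'rV[R]_3) :
  null1 x -> null1 y -> x <> y -> dot x y < 0.
Proof.
move=> hx hy xy; rewrite lt_neqAle dot_null1_le0 // andbT.
apply/eqP => xy0; apply: xy; move: hx hy xy0.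
move=> [[_ +] x2] [[_ +] y2]; rewrite /dot x2 y2 => xx yy xy0.
have s : (x 0 0 - y 0 0) ^+ 2 + (x 0 1 - y 0 1) ^+ 2 = 0 by nra.
move/eqP: s; rewrite paddr_eq0 ?sqr_ge0 // !sqrf_eq0 !subr_eq0.
by move=> /andP[/eqP e0 /eqP e1]; apply: vec3P; rewrite // x2 y2.
Qed.

(** * Null frames and reversal of the director *)

Lemma null_frame_facts (R : realType) (u : 'rV[R]_3) : spacelike u ->
  [/\ null1 (nullm u), null1 (nullp u),
      dot u (nullm u) = 0 /\ dot u (nullp u) = 0,
      0 < det3 u (nullm u) (nullp u) & dot (nullm u) (nullp u) < 0].
Proof.
move=> /null_frameP[/= hm hp ho hd].
have um : orth u (nullm u).
  by rewrite ho; exists 1 => //; exists 0 => //; rewrite scale1r scale0r addr0.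
have up : orth u (nullp u).
  by rewrite ho; exists 0 => //; exists 1 => //; rewrite scale1r scale0r add0r.
split=> //; first by rewrite dotC um dotC up.
apply: dot_null1_lt0 => // e; move: hd.
by rewrite e det3_xyy ltxx.
Qed.

Lemma spacelikeN (R : realType) (u : 'rV[R]_3) : spacelike u -> spacelike (- u).
Proof. by case=> u0 uu; split; rewrite ?oppr_eq0 // dotNl dotNr opprK. Qed.

Lemma orthN (R : realType) (u : 'rV[R]_3) : orth (- u) = orth u.
Proof.
apply/seteqP; split=> x; rewrite /orth /= dotNr => /eqP.
  by rewrite oppr_eq0 => /eqP.
by move=> /eqP ->; rewrite oppr0.
Qed.

Lemma planeC (R : realType) (x y : 'rV[R]_3) : plane x y = plane y x.
Proof.
by apply/seteqP; split=> _ [a _ [b _ <-]];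
  exists b => //; exists a => //; rewrite addrC.
Qed.

(** Reversing [u] keeps its orthogonal plane but flips the determinant, so uniqueness of the null
    frame forces the exchange. *)
Lemma null_frameN (R : realType) (u : 'rV[R]_3) : spacelike u ->
  nullm (- u) = nullp u /\ nullp (- u) = nullm u.
Proof.
move=> su; have := null_frameP (spacelikeN su).
have : is_null_frame (- u) (nullp u, nullm u).
  have [/= hm hp ho hd] := null_frameP su; split=> //=.
    by rewrite orthN ho planeC.
  by rewrite det3N1 det3_swap23 opprK.
by move=> /is_null_frame_unique h /h -/(_ (spacelikeN su))[].
Qed.

Lemma crooked_planeN (R : realType) (p u : 'rV[R]_3) : spacelike u ->
  crooked_plane p (- u) = crooked_plane p u.
Proof.
move=> /null_frameN[em ep].
rewrite /crooked_plane /stem orthN /wingp /wingm em ep.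
by rewrite -!setUA [translate p _ `|` translate p (_ `&` _)]setUC.
Qed.

(** * Determinant signs on a crooked plane *)

Lemma det3_null_frame_gt0 (R : realType) (u x : 'rV[R]_3) : spacelike u ->
  0 < dot u x -> 0 < det3 x (nullm u) (nullp u).
Proof.
move=> su ux; have [_ _ [um up] hd _] := null_frame_facts su.
have := dot_det3 x u (nullm u) (nullp u) u.
rewrite [dot x u]dotC [dot (nullm u) u]dotC [dot (nullp u) u]dotC um up => e.
have uu := su.2.
rewrite -(pmulr_rgt0 _ uu).
have := mulr_gt0 ux hd; lra.
Qed.

(** Pairing [dot_det3] with [nullp y] shows that [det3 y x (nullp y)] is a nonnegative multiple of
    [det3 y (nullm y) (nullp y)]. *)
Lemma wing_det3_le0 (R : realType) (x y : 'rV[R]_3) :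
  spacelike y -> dot y (nullp y) = 0 -> null1 x -> det3 (nullp y) x y <= 0.
Proof.
move=> sy yp hx; have [hm hp [ym _] hd mp] := null_frame_facts sy.
have := dot_det3 y x (nullm y) (nullp y) (nullp y).
rewrite yp hp.1.2 => e.
have xp := dot_null1_le0 hx hp.
rewrite det3_swap12 det3_swap23 opprK det3_swap12.
have := det3_swap23 y x (nullp y) => e1.
nra.
Qed.

Lemma crooked_plane_det3_le0 (R : realType) (p u y : 'rV[R]_3) :
  spacelike u -> crooked_plane p u y ->
  exists2 n, n \in [:: nullm u; nullp u] &
    forall x, null1 x -> 0 < dot u x -> det3 n x (y - p) <= 0.
Proof.
move=> su; have [hm hp [um up] hd mp] := null_frame_facts su.
case=> [[]|] [z + <-]; rewrite addrC addKr.
- move=> [+ /= zz]; have [_ _ /= -> _] := null_frameP su.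
  move=> [a _ [b _ zE]].
  have ab : 0 <= a * b.
    move: zz; rewrite -zE dot_lin ![dot (_ + _) _]dotC !dot_lin hm.1.2 hp.1.2.
    by rewrite [dot (nullp u) _]dotC; nra.
  have dm x : det3 (nullm u) x z = - b * det3 x (nullm u) (nullp u).
    by rewrite -zE det3_lin det3_xyx det3_swap12; ring.
  have dp x : det3 (nullp u) x z = a * det3 x (nullm u) (nullp u).
    rewrite -zE det3_lin det3_xyx det3_swap12 det3_swap23; ring.
  (* The sign of [b] selects the null vector: as [a * b >= 0], [b < 0] forces [a <= 0]. *)
  have [b0|b0] := leP 0 b.
    exists (nullm u); first by rewrite mem_head.
    move=> x _ /(det3_null_frame_gt0 su) hx; rewrite dm; nra.
  exists (nullp u); first by rewrite !inE eqxx orbT.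
  move=> x _ /(det3_null_frame_gt0 su) hx; rewrite dp.
  have a0 : a <= 0 by nra.
  nra.
(* On either wing, [n] is the null vector orthogonal to that wing, which is [nullp z]. *)
- move=> [zp /= [sz zE]]; exists (nullp u); first by rewrite !inE eqxx orbT.
  by move=> x hx _; rewrite -zE wing_det3_le0 // zE.
- move=> [zm /= [sz zE]]; exists (nullm u); first by rewrite mem_head.
  by move=> x hx _; rewrite -zE wing_det3_le0 // zE.
Qed.

Lemma null1_null_frame (R : realType) (u n : 'rV[R]_3) : spacelike u ->
  n \in [:: nullm u; nullp u] -> null1 n /\ dot u n = 0.
Proof.
move=> su; have [hm hp [um up] _ _] := null_frame_facts su.
by rewrite !inE => /orP[] /eqP ->.
Qed.

(** * Strict separation of null directions and positivity along the path *)

Lemma ultraparallel_dot_neq0 (R : realType) (u v n : 'rV[R]_3) :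
  spacelike u -> ultraparallel u v -> n \in [:: nullm u; nullp u] ->
  dot v n != 0.
Proof.
move=> su [w [w0 ww] uvw] /(null1_null_frame su)[[[n0 nn] _] un].
apply/eqP => vn.
have : line w n by rewrite -uvw; split; rewrite /orth /= dotC.
move=> [a _ naw]; move: nn n0; rewrite -naw.
have -> : dot (a *: w) (a *: w) = a ^+ 2 * dot w w by rewrite /dot !mxE; ring.
move=> /eqP; rewrite mulf_eq0 sqrf_eq0 (gt_eqF ww) orbF => /eqP ->.
by rewrite scale0r eqxx.
Qed.

Lemma ultraparallelC (R : realType) (u v : 'rV[R]_3) :
  ultraparallel u v -> ultraparallel v u.
Proof. by case=> w sw e; exists w; rewrite // setIC. Qed.

(** Consistent orientation gives weak inequalities; ultraparallelism makes them strict, since a null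
    vector cannot lie on a spacelike line. *)
Lemma consistently_oriented_dot (R : realType) (u v : 'rV[R]_3) :
  spacelike u -> spacelike v -> ultraparallel u v ->
  consistently_oriented v (- u) ->
  (forall n, n \in [:: nullm u; nullp u] -> dot v n < 0) /\
  (forall n, n \in [:: nullm v; nullp v] -> 0 < dot u n).
Proof.
move=> su sv uv [_ _ _ _ h].
have [hv1 hv2] : dot v (nullm (- u)) <= 0 /\ dot v (nullp (- u)) <= 0.
  by apply: h; rewrite !inE eqxx ?orbT.
have [hu1 hu2] : dot (- u) (nullm v) <= 0 /\ dot (- u) (nullp v) <= 0.
  by apply: h; rewrite !inE eqxx ?orbT.
have [em ep] := null_frameN su.
move: hv1 hv2 hu1 hu2; rewrite em ep !dotNl !oppr_le0 => hv1 hv2 hu1 hu2.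
split=> n hn; rewrite lt_neqAle.
- rewrite (ultraparallel_dot_neq0 su uv hn) /=.
  by move: hn; rewrite !inE => /orP[] /eqP ->.
- rewrite eq_sym (ultraparallel_dot_neq0 sv (ultraparallelC uv) hn) /=.
  by move: hn; rewrite !inE => /orP[] /eqP ->.
Qed.

(* [x] and [x'] lie on either side of the chord joining [e] and [f], so that
   [x], [f], [x'], [e] are in cyclic order on the circle of null directions. *)
Lemma det3_null1_gt0 (R : realType) (x f x' e : 'rV[R]_3) :
  null1 x -> null1 f -> null1 x' -> null1 e ->
  0 < det3 x f e -> 0 < det3 f x' e ->
  0 < det3 x f x' /\ 0 < det3 x x' e.
Proof.
move=> hx hf hx' he d1 d2.
have ef : dot e f < 0.
  by apply: dot_null1_lt0 => // E; move: d1; rewrite E det3_xyy ltxx.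
have xf : dot x f < 0.
  apply: dot_null1_lt0 => // E; move: d1.
  by rewrite E det3_swap23 det3_xyx oppr0 ltxx.
have xe : dot x e < 0.
  by apply: dot_null1_lt0 => // E; move: d1; rewrite E det3_xyx ltxx.
have x'f := dot_null1_le0 hx' hf.
have x'e := dot_null1_le0 hx' he.
(* Pairing with the null vectors [f] and [e] kills one term each and leaves one wanted determinant
   in each relation. *)
have := dot_det3 x f x' e f; have := dot_det3 x f x' e e.
rewrite he.1.2 hf.1.2 [dot f e]dotC => e1 e2.
split.
- rewrite -(nmulr_rlt0 _ ef).
  have := nmulr_rlt0 (det3 f x' e) xf; rewrite d2.
  have := mulr_le0_ge0 x'f (ltW d1); lra.
- rewrite -(nmulr_rlt0 _ ef).
  have := nmulr_rlt0 (det3 f x' e) xe; rewrite d2.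
  have := mulr_le0_ge0 x'e (ltW d1); lra.
Qed.

(** The minus sign in the quadrant makes the value a combination, with coefficients [a] and [b], of
    two determinants positive by [det3_null1_gt0]. *)
Lemma stem_quadrant_det3_gt0 (R : realType) (u v x x' : 'rV[R]_3) :
  spacelike u -> stem_quadrant u v -> null1 x -> null1 x' ->
  dot u x < 0 -> 0 < dot u x' -> 0 < det3 x x' v.
Proof.
move=> su [[a /= a0 [b /= b0 vE]] /= v0] hx hx' ux ux'.
have [hm hp _ _ _] := null_frame_facts su.
have d1 : 0 < det3 x (nullp u) (nullm u).
  rewrite det3_swap23 -det3N1; apply: det3_null_frame_gt0 => //.
  by rewrite dotNr oppr_gt0.
have d2 : 0 < det3 (nullp u) x' (nullm u).
  by rewrite det3_swap12 det3_swap23 opprK; exact: det3_null_frame_gt0.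
have [d3 d4] := det3_null1_gt0 hx hp hx' hm d1 d2.
have -> : det3 x x' v =
    a * det3 x x' (nullm u) + b * det3 x (nullp u) x'.
  by rewrite -vE -scaleNr det3_lin [det3 x x' (nullp u)]det3_swap23; ring.
have ad := mulr_ge0 a0 (ltW d4); have bd := mulr_ge0 b0 (ltW d3).
rewrite lt_neqAle addr_ge0 // andbT eq_sym paddr_eq0 // !mulf_eq0.
rewrite (gt_eqF d3) (gt_eqF d4) !orbF.
apply/negP => /andP[/eqP a00 /eqP b00]; apply: v0.
by rewrite -vE a00 b00 !scale0r subr0.
Qed.

Lemma det3_MVT (R : realType) (x y : 'rV[R]_3) (p : R -> 'rV[R]_3) (t s : R) :
  t < s -> (forall r, derivable p r 1) ->
  exists2 r, t < r < s &
    det3 x y (p s - p t) = det3 x y (derive1 p r) * (s - t).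
Proof.
move=> ts dp.
have dpi i (r : R) :
    is_derive r 1 (fun q : R => p q 0 i : R) (derive1 p r 0 i : R).
  rewrite derive1E derive_mx // mxE.
  by apply: derivableP; move/derivable_mxP: (dp r).
(* Written in coordinates, this scalar linear form can be differentiated termwise along [p]. *)
pose f (v : 'rV[R]_3) := \sum_i det3 x y (delta_mx 0 i) * v 0 i.
have fE v : det3 x y v = f v.
  rewrite /f !big_ord_recl big_ord0 !det_cols3 !mxE /=.
  have -> : lift ord0 ord0 = 1 :> 'I_3 by apply: val_inj.
  have -> : lift ord0 (lift ord0 ord0) = 2 :> 'I_3 by apply: val_inj.
  by rewrite /=; ring.
have df (r : R) : is_derive r 1 (f \o p) (f (derive1 p r)).
  have -> : f \o p =
      \sum_i (det3 x y (delta_mx 0 i) *: (fun q : R => p q 0 i : R)).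
    by apply/funext => z; rewrite /= fct_sumE.
  by apply: is_derive_sum.
have [r rts rE] : exists2 r, r \in `]t, s[%R &
    (f \o p) s - (f \o p) t = f (derive1 p r) * (s - t).
  apply: (@MVT _ (f \o p)) => //.
  apply: derivable_within_continuous => r _; by case: (df r).
by exists r; rewrite // det3B !fE.
Qed.

Theorem theorem3p3 (R : realType) (u p : R -> 'rV[R]_3)
  (u_normalized : normalized_path u)
  (u_ultraparallel : forall s t : R, s != t -> ultraparallel (u s) (u t))
  (p_regular : regular_curve p)
  (dp_quadrant : forall t : R, stem_quadrant (u t) (p^`() t)) :
  crooked_foliation p u.
Proof.
have [uc su _ uor] := u_normalized; split=> //.
have dp r : derivable p r 1 := p_regular.1 0%N r.
have dot_u t s : t < s ->
    (forall n, n \in [:: nullm (u t); nullp (u t)] -> dot (u s) n < 0) /\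
    (forall n, n \in [:: nullm (u s); nullp (u s)] -> 0 < dot (u t) n).
  move=> ts; apply: consistently_oriented_dot => //; last exact: uor.
  by apply: u_ultraparallel; rewrite lt_eqF.
suff H t s : t < s ->
    crooked_plane (p t) (u t) `&` crooked_plane (p s) (u s) = set0.
  move=> s t; rewrite neq_lt => /orP[/H //|/H]; by rewrite setIC.
move=> ts; apply/seteqP; split=> // y [yt].
(* With the director reversed, the null directions of [u t] are on its positive side, as
   [crooked_plane_det3_le0] requires. *)
rewrite -crooked_planeN // => ys.
have [n nt yn] := crooked_plane_det3_le0 (su t) yt.
have [n' ns yn'] := crooked_plane_det3_le0 (spacelikeN (su s)) ys.
have {}ns : n' \in [:: nullm (u s); nullp (u s)].
  move: ns; have [-> ->] := null_frameN (su s).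
  by rewrite !inE orbC.
have [hn _] := null1_null_frame (su t) nt.
have [hn' _] := null1_null_frame (su s) ns.
have [ut us] := dot_u t s ts.
have le1 : det3 n n' (y - p t) <= 0 by apply: yn => //; exact: us.
have le2 : det3 n' n (y - p s) <= 0.
  by apply: yn' => //; rewrite dotNl oppr_gt0; exact: ut.
have [r /andP[tr rs] rE] := det3_MVT n n' ts dp.
(* Comparing [r] with [t] puts [n] on the negative side of [u r]; comparing it with [s] puts [n'] on
   the positive side. *)
have gt0 : 0 < det3 n n' (derive1 p r).
  apply: (@stem_quadrant_det3_gt0 _ (u r)) => //.
    exact: (dot_u t r tr).1.
  exact: (dot_u r s rs).2.
have : 0 < det3 n n' (derive1 p r) * (s - t) by rewrite mulr_gt0 // subr_gt0.
move: le2; rewrite -rE det3_swap12; move: le1; rewrite !det3B; lra.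
Qed.
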